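(* Let $S$ be an inverse semigroup, let $\mathcal{A}$ be an associative and commutative ring, and let $\pi=(\{\pi_s\}_{s\in S},\{D_s\}_{s\in S})$ be a partial action of $S$ on $\mathcal{A}$ such that $\mathcal{A}$ and every ideal $D_s$, $s\in S$, have local units. Then the following two assertions are equivalent: (i) The skew inverse semigroup ring $\mathcal{A}\rtimes_\pi S$ is simple; (ii) $\mathcal{A}$ is $S$-simple, and $\mathcal{A}\cong\mathcal{D}$ is a maximal commutative subring of $\mathcal{A}\rtimes_\pi S$.
   Context: An inverse semigroup is a semigroup $S$ such that each $s\in S$ has a unique $s^*\in S$ with $ss^*s=s$ and $s^*ss^*=s^*$. $E(S)=\{e\in S\mid e^2=e\}$. The natural partial order is $s\le t \iff s=ts^*s \iff s=ss^*t$. Rings are not assumed unital; ideals are two-sided. A ring $Q$ has local units if for every finite subset $\mathcal F\subseteq Q$ there is an idempotent $f\in Q$ with $\mathcal F\subseteq fQf$. A partial action of $S$ on a ring $\mathcal{A}$ is a collection of ideals $\{D_s\}_{s\in S}$ of $\mathcal{A}$ and ring isomorphisms $\{\pi_s:D_{s^*}\to D_s\}_{s\in S}$ such that for all $s,t\in S$: (i) $\mathcal{A}$, as an additive group, is generated by $\bigcup_{e\in E(S)}D_e$; (ii) $\pi_s(D_{s^*}\cap D_t)=D_s\cap D_{st}$; (iii) $\pi_s(\pi_t(x))=\pi_{st}(x)$ for all $x\in D_{t^*}\cap D_{t^*s^*}$. Skew inverse semigroup ring: let $\mathcal{L}$ be the set of finite formal sums $\sum_{s\in S}a_s\delta_s$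 with $a_s\in D_s$, with componentwise addition and multiplication determined additively by $(a_s\delta_s)(b_t\delta_t)=\pi_s(\pi_{s^*}(a_s)b_t)\delta_{st}$. Under the local units assumption $\mathcal{L}$ is an associative ring. Let $\mathcal{N}$ be the ideal of $\mathcal{L}$ generated by all elements $a\delta_r-a\delta_s$ with $r,s\in S$, $r\le s$, $a\in D_r$ (one has $D_r\subseteq D_s$ when $r\leq s$). Then $\mathcal{A}\rtimes_\pi S:=\mathcal{L}/\mathcal{N}$, and $\overline{x}$ denotes the class of $x\in\mathcal{L}$. The diagonal is $\mathcal{D}=\{\sum_{i=1}^n\overline{a_i\delta_{e_i}}\mid n\in\mathbb{Z}_+,\ e_i\in E(S),\ a_i\in D_{e_i}\}\subseteq \mathcal{A}\rtimes_\pi S$. The ring $\mathcal{A}$ is identified with $\mathcal{D}$ via the ring isomorphism $\phi:\mathcal{A}\to\mathcal{D}$, $\sum_i a_{e_i}\mapsto\sum_i\overline{a_{e_i}\delta_{e_i}}$ (where $a_{e_i}\in D_{e_i}$, $e_i\in E(S)$). The centralizer $C_Q(M)$ of a non-empty subset $M$ of a ring $Q$ is the set of elements of $Q$ commuting with every element of $M$; $M$ is maximal commutative in $Q$ if $C_Q(M)=M$. An ideal $I$ of $\mathcal{A}$ is $S$-invariant if $\pi_s(I\cap D_{s^*})\subseteq I$ for all $s\in S$; $\mathcal{A}$ is $S$-simple if it has no non-zero $S$-invariant proper ideal. A ring is simple if it has no non-zero proper ideal. *)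

(* Defs.v *)
From HB Require Import structures.
From mathcomp Require Import all_boot all_algebra.
From mathcomp Require Import finmap boolp classical_sets functions.
From mathcomp Require Import monalg.

Set Implicit Arguments.
Unset Strict Implicit.
Unset Printing Implicit Defensive.

Import GRing.Theory.

Local Open Scope classical_set_scope.
Local Open Scope ring_scope.
Local Open Scope quotient_scope.

Reserved Notation "x ** y" (at level 40, left associativity).

HB.mixin Record Semigroup_isInverse S of Semigroup S := {
  star : S -> S;
  mulgKstar : forall s : S, (s * star s * s = s)%g;
  starKmulg : forall s : S, (star s * s * star s = star s)%g;
  star_unique : forall s t : S,
    (s * t * s = s)%g -> (t * s * t = t)%g -> t = star s
}.

#[short(type="inverseSemigroupType")]
HB.structure Definition InverseSemigroup :=
  {S of Semigroup_isInverse S & Semigroup S}.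

Notation "s ^*" := (star s) : group_scope.

Section InverseSemigroup.
Context {S : inverseSemigroupType}.
Implicit Types s t e f r : S.

Definition idem : set S := [set e | e * e = e]%g.

Definition natle s t := (s = t * s^* * s)%g.

Lemma star_star s : (s^*^*)%g = s.
Proof. by rewrite -(@star_unique S s^*%g s) ?mulgKstar ?starKmulg. Qed.

Lemma star_idem e : idem e -> (e^*)%g = e.
Proof. by rewrite /idem /= => h; rewrite -(@star_unique S e e) // !h. Qed.

Lemma idem_star_mul s : idem (s^* * s)%g.
Proof. by rewrite /idem /= mulgA starKmulg. Qed.

Lemma idem_mul_star s : idem (s * s^*)%g.
Proof. by rewrite /idem /= mulgA mulgKstar. Qed.

Lemma idemM e f : idem e -> idem f -> idem (e * f)%g.
Proof.
rewrite /idem /= => he hf.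
set x := ((e * f)^*)%g.
have h1 : (e * f * x * (e * f) = e * f)%g by rewrite mulgKstar.
have h2 : (x * (e * f) * x = x)%g by rewrite starKmulg.
have xE : (f * x * e)%g = x.
  apply: star_unique; rewrite !mulgA.
    by rewrite -(mulgA e f f) hf -(mulgA _ e e) he -[RHS]h1 !mulgA.
  rewrite -(mulgA (f * x)%g e e) he -(mulgA (f * x * e)%g f f) hf.
  by rewrite -{3}h2 !mulgA.
have xx : (x * x = x)%g.
  have -> : (x * x = f * (x * (e * f) * x) * e)%g.
    by rewrite -{1 2}xE !mulgA.
  by rewrite h2.
have -> : (e * f)%g = x.
  by rewrite -(star_star (e * f)%g) -/x star_idem.
exact: xx.
Qed.

Lemma idemC e f : idem e -> idem f -> (e * f = f * e)%g.
Proof.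
move=> he hf; have hef := idemM he hf; have hfe := idemM hf he.
rewrite -[LHS]star_idem //; apply/esym/star_unique; move: he hf hef hfe;
  rewrite /idem /= => he hf hef hfe; rewrite !mulgA.
  by rewrite -(mulgA e f f) hf -(mulgA _ e e) he -[RHS]hef !mulgA.
by rewrite -(mulgA f e e) he -(mulgA _ f f) hf -[RHS]hfe !mulgA.
Qed.

Lemma starM s t : ((s * t)^* = t^* * s^*)%g.
Proof.
have c := idemC (idem_mul_star t) (idem_star_mul s).
apply/esym/star_unique.
  have -> : (s * t * (t^* * s^*) * (s * t) = s * (t * t^* * (s^* * s)) * t)%g.
    by rewrite !mulgA.
  by rewrite c !mulgA mulgKstar -!mulgA (mulgA t) mulgKstar.
have -> : (t^* * s^* * (s * t) * (t^* * s^*) =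
           t^* * (s^* * s * (t * t^*)) * s^*)%g by rewrite !mulgA.
by rewrite -c !mulgA starKmulg -!mulgA (mulgA s^*%g) starKmulg.
Qed.

Lemma natleE s t : natle s t <-> (s = s * s^* * t)%g.
Proof.
rewrite /natle; split=> h.
- have e := idem_star_mul s.
  have h' : s = (t * (s^* * s))%g by rewrite mulgA.
  have hs : (s^* = s^* * s * t^*)%g by rewrite {1}h' starM (star_idem e).
  have -> : (s * s^* * t = s * s^* * s * t^* * t)%g by rewrite {1}hs !mulgA.
  rewrite mulgKstar {2}h'.
  have -> : (t * (s^* * s) * t^* * t = t * (s^* * s * (t^* * t)))%g.
    by rewrite !mulgA.
  by rewrite (idemC e (idem_star_mul t)) !mulgA mulgKstar -mulgA.
- have e := idem_mul_star s.
  have hs : (s^* = t^* * (s * s^*))%g by rewrite {1}h starM (star_idem e).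
  have -> : (t * s^* * s = t * t^* * (s * s^*) * s)%g by rewrite {1}hs !mulgA.
  rewrite (idemC (idem_mul_star t) e).
  have -> : (s * s^* * (t * t^*) * s = s * s^* * (t * t^*) * (s * s^* * t))%g.
    by rewrite -h.
  have -> : (s * s^* * (t * t^*) * (s * s^* * t) =
     s * s^* * ((t * t^*) * (s * s^*)) * t)%g by rewrite !mulgA.
  rewrite (idemC (idem_mul_star t) e).
  have -> : (s * s^* * (s * s^* * (t * t^*)) * t =
     s * s^* * (s * s^*) * (t * t^* * t))%g by rewrite !mulgA.
  by rewrite mulgKstar e -h.
Qed.

Lemma natle_mull e s : idem e -> natle (e * s)%g s.
Proof.
move=> he; apply/natleE; rewrite starM (star_idem he).
have -> : (e * s * (s^* * e) * s = e * (s * s^* * e) * s)%g by rewrite !mulgA.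
rewrite (idemC (idem_mul_star s) he).
have -> : (e * (e * (s * s^*)) * s = e * e * (s * s^* * s))%g.
  by rewrite !mulgA.
by rewrite he mulgKstar.
Qed.

Lemma natle_mulr e s : idem e -> natle (s * e)%g s.
Proof.
move=> he; rewrite /natle starM (star_idem he).
have -> : (s * (e * s^*) * (s * e) = s * (e * (s^* * s)) * e)%g.
  by rewrite !mulgA.
rewrite (idemC he (idem_star_mul s)).
have -> : (s * (s^* * s * e) * e = s * s^* * s * (e * e))%g by rewrite !mulgA.
by rewrite he mulgKstar.
Qed.

Lemma natleMr r s t : natle r s -> natle (r * t)%g (s * t)%g.
Proof.
by move=> /natleE ->; rewrite -mulgA; apply: natle_mull; exact: idem_mul_star.
Qed.

Lemma natleMl r s t : natle r s -> natle (t * r)%g (t * s)%g.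
Proof.
move=> ->; rewrite -!mulgA [X in natle X _]mulgA.
by apply: natle_mulr; exact: idem_star_mul.
Qed.

End InverseSemigroup.

HB.mixin Record Zmodule_isRng R of GRing.Zmodule R := {
  rngM : R -> R -> R;
  rngMA : associative rngM;
  rngMDl : left_distributive rngM +%R;
  rngMDr : right_distributive rngM +%R
}.

#[short(type="rngType")]
HB.structure Definition Rng := {R of Zmodule_isRng R & GRing.Zmodule R}.

Notation "x ** y" := (rngM x y) : ring_scope.

HB.mixin Record Rng_isCommutative R of Rng R := {
  rngMC : commutative (@rngM R)
}.

#[short(type="comRngType")]
HB.structure Definition ComRng := {R of Rng_isCommutative R & Rng R}.

Section Rng.
Context {R : rngType}.
Implicit Types (x y z : R) (I M X : set R).

Definition subgroup I := I 0 /\ forall x y, I x -> I y -> I (x - y).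

Definition ideal I :=
  subgroup I /\ forall a x, I x -> I (a ** x) /\ I (x ** a).

Definition simple_rng := forall I, ideal I -> I = [set 0] \/ I = setT.

(* [f Q f] is understood inside the subring [M], seen as a ring in itself. *)
Definition has_local_units M := forall F : seq R,
  (forall x, x \in F -> M x) ->
  exists f, [/\ M f, f ** f = f &
    forall x, x \in F -> exists2 y, M y & x = f ** y ** f].

Definition centralizer M : set R := [set x | forall y, M y -> x ** y = y ** x].

Definition maximal_commutative M := centralizer M = M.

Lemma rngM0 x : x ** 0 = 0.
Proof. by apply: (@addrI _ (x ** 0)); rewrite -rngMDr !addr0. Qed.

Lemma rng0M x : 0 ** x = 0.
Proof. by apply: (@addrI _ (0 ** x)); rewrite -rngMDl !addr0. Qed.

Lemma rngMN x y : x ** (- y) = - (x ** y).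
Proof. by apply: (@addrI _ (x ** y)); rewrite -rngMDr !subrr rngM0. Qed.

Lemma rngNM x y : (- x) ** y = - (x ** y).
Proof. by apply: (@addrI _ (x ** y)); rewrite -rngMDl !subrr rng0M. Qed.

Lemma rngMBr x y z : x ** (y - z) = x ** y - x ** z.
Proof. by rewrite rngMDr rngMN. Qed.

Lemma rngMBl x y z : (y - z) ** x = y ** x - z ** x.
Proof. by rewrite rngMDl rngNM. Qed.

Lemma rngM_suml (J : Type) (r : seq J) (F : J -> R) x :
  (\sum_(j <- r) F j) ** x = \sum_(j <- r) F j ** x.
Proof. by elim/big_rec2: _ => [|j y z _ <-]; rewrite ?rng0M ?rngMDl. Qed.

Lemma rngM_sumr (J : Type) (r : seq J) (F : J -> R) x :
  x ** (\sum_(j <- r) F j) = \sum_(j <- r) x ** F j.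
Proof. by elim/big_rec2: _ => [|j y z _ <-]; rewrite ?rngM0 ?rngMDr. Qed.

Lemma subgroupN I x : subgroup I -> I x -> I (- x).
Proof. by case=> i0 iB ix; rewrite -sub0r; apply: iB. Qed.

Lemma subgroupD I x y : subgroup I -> I x -> I y -> I (x + y).
Proof.
by move=> iI ix iy; rewrite -[y]opprK; apply: iI.2 => //; apply: subgroupN.
Qed.

Lemma subgroup_sum I (J : eqType) (r : seq J) (F : J -> R) :
  subgroup I -> (forall j, j \in r -> I (F j)) -> I (\sum_(j <- r) F j).
Proof.
move=> iI; rewrite big_seq => iF; elim/big_ind: _ => //; first exact: iI.1.
by move=> *; apply: subgroupD.
Qed.

Lemma subgroup_smallest X : subgroup (smallest subgroup X).
Proof.
split; first by move=> I [iI _]; exact: iI.1.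
by move=> x y hx hy I hI; apply: hI.1.2; [exact: hx | exact: hy].
Qed.

Lemma ideal_smallest X : ideal (smallest ideal X).
Proof.
split.
  split; first by move=> I [iI _]; exact: iI.1.1.
  by move=> x y hx hy I hI; apply: hI.1.1.2; [exact: hx | exact: hy].
move=> a x hx; split=> I hI.
  exact: (hI.1.2 a x (hx I hI)).1.
exact: (hI.1.2 a x (hx I hI)).2.
Qed.

End Rng.

Arguments simple_rng R : clear implicits.

Section Quotient.
Context {R : rngType} (X : set R).

Definition ideal_pred : pred R := fun x => `[< smallest ideal X x >].

Fact ideal_pred_zmod_closed : zmod_closed ideal_pred.
Proof.
have [[i0 iB] _] := ideal_smallest X.
by split=> [|x y /asboolP hx /asboolP hy]; apply/asboolP; [|exact: iB].
Qed.

HB.instance Definition _ :=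
  GRing.isZmodClosed.Build R ideal_pred ideal_pred_zmod_closed.

Definition rng_quot := Quotient.quot (GRing.ZmodClosed.clone R ideal_pred _).

HB.instance Definition _ := GRing.Zmodule.on rng_quot.

Definition rng_pi (x : R) : rng_quot := \pi_rng_quot x.

Lemma rng_piE x y : rng_pi x = rng_pi y <-> smallest ideal X (x - y).
Proof.
rewrite /rng_pi; split=> [/eqP|h].
  by rewrite -Quotient.idealrBE => /asboolP.
by apply/eqP; rewrite -Quotient.idealrBE; apply/asboolP.
Qed.

Lemma rng_piP (q : rng_quot) : exists x, q = rng_pi x.
Proof. by exists (repr q); rewrite /rng_pi reprK. Qed.

Lemma rng_piB : {morph rng_pi : x y / x - y}.
Proof. by move=> x y; rewrite /rng_pi !piE. Qed.

HB.instance Definition _ :=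
  GRing.isZmodMorphism.Build R rng_quot rng_pi rng_piB.

Lemma rng_piD : {morph rng_pi : x y / x + y}.
Proof. exact: raddfD. Qed.

Definition rng_quot_mul (p q : rng_quot) : rng_quot :=
  rng_pi (repr p ** repr q).

Lemma rng_piM_subproof x y :
  rng_quot_mul (rng_pi x) (rng_pi y) = rng_pi (x ** y).
Proof.
have [[i0 iB] iM] := ideal_smallest X.
have hr z : smallest ideal X (repr (rng_pi z) - z).
  by apply/rng_piE; rewrite /rng_pi reprK.
apply/rng_piE; set x' := repr _; set y' := repr _.
rewrite -[_ - _](subrKA (x' ** y)) -rngMBr -rngMBl.
apply: (subgroupD (I := smallest ideal X)) (iM _ _ (hr x)).2 => //.
exact: (iM _ _ (hr y)).1.
Qed.

Fact rng_quotMA : associative rng_quot_mul.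
Proof.
move=> p q r; have [[x ->] [[y ->] [z ->]]] := (rng_piP p, (rng_piP q, rng_piP r)).
by rewrite !rng_piM_subproof rngMA.
Qed.

Fact rng_quotMDl : left_distributive rng_quot_mul +%R.
Proof.
move=> p q r; have [[x ->] [[y ->] [z ->]]] := (rng_piP p, (rng_piP q, rng_piP r)).
by rewrite -rng_piD !rng_piM_subproof -rng_piD rngMDl.
Qed.

Fact rng_quotMDr : right_distributive rng_quot_mul +%R.
Proof.
move=> p q r; have [[x ->] [[y ->] [z ->]]] := (rng_piP p, (rng_piP q, rng_piP r)).
by rewrite -rng_piD !rng_piM_subproof -rng_piD rngMDr.
Qed.

HB.instance Definition _ :=
  Zmodule_isRng.Build rng_quot rng_quotMA rng_quotMDl rng_quotMDr.

Lemma rng_piM : {morph rng_pi : x y / x ** y}.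
Proof. by move=> x y; rewrite -rng_piM_subproof. Qed.

End Quotient.

(* [pact s] is total, but only its values on [pdom s^*] are constrained, and
   only these are used below. *)
Record partial_action (S : inverseSemigroupType) (A : rngType) :=
  PartialAction {
    pdom : S -> set A;
    pact : S -> A -> A;
    pdom_ideal : forall s, ideal (pdom s);
    pact_bij : forall s, set_bij (pdom s^*%g) (pdom s) (pact s);
    pactD : forall s, {in pdom s^*%g &, {morph pact s : x y / x + y}};
    pactM : forall s, {in pdom s^*%g &, {morph pact s : x y / x ** y}};
    pdom_gen : smallest subgroup (\bigcup_(e in idem) pdom e) = [set: A];
    pact_cap : forall s t : S,
      pact s @` (pdom s^*%g `&` pdom t) = pdom s `&` pdom (s * t)%g;
    pact_comp : forall (s t : S) x, pdom t^*%g x -> pdom (t^* * s^*)%g x ->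
      pact s (pact t x) = pact (s * t)%g x
  }.

Section PartialAction.
Context {S : inverseSemigroupType} {A : rngType}.
Variable p : partial_action S A.
Implicit Types (s t r e : S) (x y a b : A) (I : set A).

Local Notation D := (pdom p).
Local Notation act := (pact p).

Definition S_invariant I := forall s, act s @` (I `&` D s^*%g) `<=` I.

Definition S_simple := forall I, ideal I -> S_invariant I ->
  I = [set 0] \/ I = setT.

Lemma pdom0 s : D s 0.
Proof. by case: (pdom_ideal p s) => -[]. Qed.

Lemma pdomB s x y : D s x -> D s y -> D s (x - y).
Proof. by case: (pdom_ideal p s) => -[_ h] _; exact: h. Qed.

Lemma pdomD s x y : D s x -> D s y -> D s (x + y).
Proof. by case: (pdom_ideal p s) => h _; exact: subgroupD. Qed.

Lemma pdomN s x : D s x -> D s (- x).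
Proof. by case: (pdom_ideal p s) => h _; exact: subgroupN. Qed.

Lemma pdomMl s a x : D s x -> D s (a ** x).
Proof. by case: (pdom_ideal p s) => _ h /(h a)[]. Qed.

Lemma pdomMr s a x : D s x -> D s (x ** a).
Proof. by case: (pdom_ideal p s) => _ h /(h a)[]. Qed.

Lemma pactDE s x y : D s^*%g x -> D s^*%g y -> act s (x + y) = act s x + act s y.
Proof. by move=> dx dy; apply: pactD; rewrite inE. Qed.

Lemma pactME s x y :
  D s^*%g x -> D s^*%g y -> act s (x ** y) = act s x ** act s y.
Proof. by move=> dx dy; apply: pactM; rewrite inE. Qed.

Lemma pact0 s : act s 0 = 0.
Proof.
have h := pdom0 s^*%g; apply: (@addrI _ (act s 0)).
by rewrite -pactDE // !addr0.
Qed.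

Lemma pact_dom s x : D s^*%g x -> D s (act s x).
Proof. by case: (pact_bij p s) => h _ _; apply: h. Qed.

Lemma pact_dom_star s x : D s x -> D s^*%g (act s^*%g x).
Proof. by move=> h; apply: pact_dom; rewrite star_star. Qed.

Lemma pact_inj s x y : D s^*%g x -> D s^*%g y -> act s x = act s y -> x = y.
Proof. by case: (pact_bij p s) => _ h _ dx dy; apply: h; rewrite inE. Qed.

Lemma pact_capE s t x : D s^*%g x -> D t x -> D (s * t)%g (act s x).
Proof.
move=> dx dt; suff: (D s `&` D (s * t)%g) (act s x) by case.
by rewrite -pact_cap; exists x.
Qed.

Lemma pdom_mul_star s x : D s x -> D (s * s^*)%g x.
Proof.
move=> dx; have [_ _ /(_ x dx) [y dy <-]] := pact_bij p s.
exact: pact_capE.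
Qed.

Lemma pact_idem e x : idem e -> D e x -> act e x = x.
Proof.
move=> he dx; have se := star_idem he.
apply: (@pact_inj e); rewrite ?se //; first by apply: pact_dom; rewrite se.
rewrite pact_comp ?se //; last by rewrite he.
by rewrite he.
Qed.

Lemma pactK s x : D s x -> act s (act s^*%g x) = x.
Proof.
move=> dx; rewrite pact_comp ?star_star //; last exact: pdom_mul_star.
by rewrite pact_idem //; [exact: idem_mul_star|exact: pdom_mul_star].
Qed.

Lemma pactsK s x : D s^*%g x -> act s^*%g (act s x) = x.
Proof. by move=> /(@pactK); rewrite star_star. Qed.

Lemma pdom_capE e s x : idem e -> D e x -> D s x -> D (e * s)%g x.
Proof.
move=> he de ds; rewrite -(pact_idem he de).
by apply: pact_capE => //; rewrite star_idem.
Qed.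

Lemma pdom_sub r s x : natle r s -> D r x -> D s x.
Proof.
move=> /natleE h dr; have he := idem_mul_star r.
have: (D (r * r^*)%g `&` D (r * r^* * s)%g) x.
  by split; [exact: pdom_mul_star|rewrite -h].
rewrite -pact_cap => -[y [dy ds] <-].
by rewrite pact_idem // -(star_idem he).
Qed.

Lemma pact_sub r s x : natle r s -> D r^*%g x -> act r x = act s x.
Proof.
move=> h dx; have he := idem_star_mul r.
have de : D (r^* * r)%g x by have := pdom_mul_star dx; rewrite star_star.
rewrite {1}h -mulgA -pact_comp ?(pact_idem he de) // ?(star_idem he) //.
by rewrite -(star_idem he) -starM mulgA -h.
Qed.

Lemma natle_star r s : natle r s -> natle r^*%g s^*%g.
Proof.
by move=> /natleE h; rewrite /natle star_star {1}h !starM star_star mulgA.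
Qed.

End PartialAction.

Arguments S_simple {S A} p.

Section FormalSum.
Context {S : inverseSemigroupType} {A : rngType} (p : partial_action S A).
Implicit Types (s t r u : S) (a b c : A).

Local Notation D := (pdom p).
Local Notation act := (pact p).

Definition twist s a b := act s (act s^*%g a ** b).

Lemma twist_dom s t a b : D s a -> D t b -> D (s * t)%g (twist s a b).
Proof.
by move=> /pact_dom_star da db; apply: pact_capE; [exact: pdomMr|exact: pdomMl].
Qed.

Lemma twistDl s t a a' b : D s a -> D s a' -> D t b ->
  twist s (a + a') b = twist s a b + twist s a' b.
Proof.
move=> da da' db; rewrite /twist pactDE ?star_star // rngMDl pactDE //;
  exact/pdomMr/pact_dom_star.
Qed.

Lemma twistDr s t a b b' : D s a -> D t b -> D t b' ->
  twist s a (b + b') = twist s a b + twist s a b'.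
Proof.
move=> da db db'; rewrite /twist rngMDr pactDE //;
  exact/pdomMr/pact_dom_star.
Qed.

Lemma twist0l s b : twist s 0 b = 0.
Proof. by rewrite /twist pact0 rng0M pact0. Qed.

Lemma twist0r s a : twist s a 0 = 0.
Proof. by rewrite /twist rngM0 pact0. Qed.

Hypothesis lu : forall s, has_local_units (D s).

Lemma local_unit s a : D s a -> exists2 f, D s f & f ** a = a.
Proof.
move=> da; have [x|f [df ff]] := @lu s [:: a].
  by rewrite inE => /eqP ->.
move=> /(_ a); rewrite inE eqxx => /(_ isT)[y _ ay]; exists f => //.
by rewrite ay !rngMA ff.
Qed.

Lemma twistA s t u a b c : D s a -> D t b -> D u c ->
  twist (s * t)%g (twist s a b) c = twist s a (twist t b c).
Proof.
move=> /pact_dom_star; rewrite /twist; set a' := act s^*%g a => da db dc.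
have da'b : D s^*%g (a' ** b) by exact: pdomMr.
have da'bt : D t (a' ** b) by exact: pdomMl.
have -> : act (s * t)^*%g (act s (a' ** b)) = act t^*%g (a' ** b).
  rewrite starM -pact_comp ?pactsK ?star_star //; first exact: pact_dom.
  exact: pact_capE.
have dt : D t^*%g (act t^*%g (a' ** b)) by exact: pact_dom_star.
have dts : D (t^* * s^*)%g (act t^*%g (a' ** b)).
  by apply: pact_capE; rewrite ?star_star.
rewrite -pact_comp; [|exact: pdomMr|exact: pdomMr].
congr (act s _).
have [f df fb] := local_unit db.
have dbt := pact_dom_star db; have dft := pact_dom_star df.
rewrite -{1}fb rngMA (@pactME _ _ p t^*%g) ?star_star //; last exact: pdomMl.
rewrite -rngMA (@pactME _ _ p t); [|exact/pact_dom_star/pdomMl|exact: pdomMr].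
rewrite pactK; last exact: pdomMl.
rewrite -rngMA; congr (a' ** _).
rewrite -{1}(pactK df) -(@pactME _ _ p t) //; last exact: pdomMr.
by rewrite rngMA -(@pactME _ _ p t^*%g) ?star_star // fb.
Qed.

End FormalSum.

Section FormalSumRing.
Context {S : inverseSemigroupType} {A : rngType} {p : partial_action S A}.
Variable lu : forall s, has_local_units (pdom p s).
Implicit Types (s t r u : S) (a b c : A).

Local Notation D := (pdom p).
Local Notation act := (pact p).

Definition formal : pred {malg A[S]} := fun x => `[< forall s, D s x@_s >].

Fact formal_zmod_closed : zmod_closed formal.
Proof.
split=> [|x y /asboolP hx /asboolP hy]; apply/asboolP => s.
  by rewrite mcoeff0; exact: pdom0.
by rewrite mcoeffB; exact: pdomB.
Qed.

HB.instance Definition _ :=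
  GRing.isZmodClosed.Build {malg A[S]} formal formal_zmod_closed.

(* The local units hypothesis is a parameter of the type because the
   associativity of the ring structure depends on it. *)
Record formal_sum (h : forall s, has_local_units (D s)) :=
  FormalSum { fs_val :> {malg A[S]}; _ : formal fs_val }.

Local Notation L := (formal_sum lu).

HB.instance Definition _ := [isSub of L for @fs_val lu].
HB.instance Definition _ := [Choice of L by <:].
HB.instance Definition _ := [SubChoice_isSubZmodule of L by <:].

Lemma fs_dom (x : L) s : D s x@_s.
Proof. by case: x => x /= /asboolP. Qed.

Definition fs_mul_val (x y : {malg A[S]}) : {malg A[S]} :=
  \sum_(s <- msupp x) \sum_(t <- msupp y)
    << twist p s x@_s y@_t *g (s * t)%g >>.

Fact fs_mul_subproof (x y : L) : formal (fs_mul_val x y).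
Proof.
rewrite /fs_mul_val.
pose V := GRing.ZmodClosed.clone _ formal _.
apply: (rpred_sum (S := V)) => s _; apply: (rpred_sum (S := V)) => t _.
apply/asboolP => u; rewrite mcoeffU; case: eqP => [<-|_]; last exact: pdom0.
by apply: twist_dom; exact: fs_dom.
Qed.

Definition fs_mul (x y : L) : L := FormalSum lu (fs_mul_subproof x y).

(* The element [a delta_s]; the value is junk ([0]) if [a] is not in [D s]. *)
Definition delta s a : L := insubd (0 : L) << a *g s >>.

Lemma deltaE s a : D s a -> delta s a = << a *g s >> :> {malg A[S]}.
Proof.
move=> da; rewrite /delta val_insubd ifT //; apply/asboolP => t.
by rewrite mcoeffU; case: eqP => [<-|_] //; exact: pdom0.
Qed.

Lemma fs_mul_valE (d1 d2 : {fset S}) (x y : {malg A[S]}) :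
  (msupp x `<=` d1)%fset -> (msupp y `<=` d2)%fset ->
  fs_mul_val x y = \sum_(s <- d1) \sum_(t <- d2)
    << twist p s x@_s y@_t *g (s * t)%g >>.
Proof.
move=> h1 h2; rewrite /fs_mul_val (big_fset_incl _ h1) => [|s _ /mcoeff_outdom ->].
  apply: eq_bigr => s _; rewrite (big_fset_incl _ h2) // => t _ /mcoeff_outdom ->.
  by rewrite twist0r monalgU0.
by rewrite big1 // => t _; rewrite twist0l monalgU0.
Qed.

Lemma fs_mulDl : left_distributive fs_mul +%R.
Proof.
move=> x y z; apply: val_inj => /=.
pose d := (msupp (x + y : {malg A[S]}) `|` (msupp x `|` msupp y))%fset.
rewrite !(@fs_mul_valE d (msupp z)) ?fsubset_refl //; last first.
- exact: fsubsetUl.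
- by rewrite /d fsubsetU // fsubsetUl orbT.
- by rewrite /d fsubsetU // fsubsetUr orbT.
rewrite -big_split; apply: eq_bigr => s _; rewrite -big_split.
apply: eq_bigr => t _; rewrite mcoeffD (@twistDl _ _ p _ t) ?monalgUD //;
  exact: fs_dom.
Qed.

Lemma fs_mulDr : right_distributive fs_mul +%R.
Proof.
move=> z x y; apply: val_inj => /=.
pose d := (msupp (x + y : {malg A[S]}) `|` (msupp x `|` msupp y))%fset.
rewrite !(@fs_mul_valE (msupp z) d) ?fsubset_refl //; last first.
- exact: fsubsetUl.
- by rewrite /d fsubsetU // fsubsetUl orbT.
- by rewrite /d fsubsetU // fsubsetUr orbT.
rewrite -big_split; apply: eq_bigr => s _; rewrite -big_split.
apply: eq_bigr => t _; rewrite mcoeffD (@twistDr _ _ p _ t) ?monalgUD //;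
  exact: fs_dom.
Qed.

Lemma fs_mul_suml (J : Type) (r : seq J) (F : J -> L) x :
  fs_mul (\sum_(j <- r) F j) x = \sum_(j <- r) fs_mul (F j) x.
Proof.
elim/big_rec2: _ => [|j y z _ <-]; last exact: fs_mulDl.
by apply: (@addrI _ (fs_mul 0 x)); rewrite -fs_mulDl !addr0.
Qed.

Lemma fs_mul_sumr (J : Type) (r : seq J) (F : J -> L) x :
  fs_mul x (\sum_(j <- r) F j) = \sum_(j <- r) fs_mul x (F j).
Proof.
elim/big_rec2: _ => [|j y z _ <-]; last exact: fs_mulDr.
by apply: (@addrI _ (fs_mul x 0)); rewrite -fs_mulDr !addr0.
Qed.

Lemma fs_mul_delta s t a b : D s a -> D t b ->
  fs_mul (delta s a) (delta t b) = delta (s * t)%g (twist p s a b).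
Proof.
move=> da db; apply: val_inj; rewrite /= !deltaE //; last exact: twist_dom.
rewrite (@fs_mul_valE [fset s] [fset t])%fset ?msuppU_le //.
by rewrite !big_seq_fset1 !mcoeffUU.
Qed.

Lemma fsE (x : L) : x = \sum_(s <- msupp x) delta s x@_s.
Proof.
apply: val_inj; rewrite [LHS]monalgE [RHS](raddf_sum val).
by apply: eq_bigr => s _; rewrite /= deltaE //; exact: fs_dom.
Qed.

Fact fs_mulA : associative fs_mul.
Proof.
move=> x y z; rewrite (fsE x) !fs_mul_suml; apply: eq_bigr => s _.
rewrite (fsE y) fs_mul_suml !fs_mul_sumr fs_mul_suml; apply: eq_bigr => t _.
rewrite (fsE z) !fs_mul_sumr; apply: eq_bigr => u _.
have [ds [dt du]] := (fs_dom x s, (fs_dom y t, fs_dom z u)).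
rewrite !fs_mul_delta //; try exact: twist_dom.
by rewrite mulgA (twistA lu ds dt du).
Qed.

HB.instance Definition _ :=
  Zmodule_isRng.Build L fs_mulA fs_mulDl fs_mulDr.

Lemma deltaM s t a b : D s a -> D t b ->
  delta s a ** delta t b =
    delta (s * t)%g (act s (act s^*%g a ** b)).
Proof. exact: fs_mul_delta. Qed.

Lemma deltaD s a b : D s a -> D s b -> delta s (a + b) = delta s a + delta s b.
Proof.
move=> da db; apply: val_inj; rewrite [RHS](raddfD val) /= !deltaE ?monalgUD //.
exact: pdomD.
Qed.

End FormalSumRing.

Section SkewRing.
Context {S : inverseSemigroupType} {A : rngType} {p : partial_action S A}.
Variable lu : forall s, has_local_units (pdom p s).
Implicit Types (s t r u e f : S) (a b c : A).

Local Notation D := (pdom p).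
Local Notation act := (pact p).
Local Notation L := (formal_sum lu).
Local Notation delta := (delta lu).

Definition skew_gen : set L := [set z | exists r s a,
  [/\ natle r s, D r a & z = delta r a - delta s a]].

Definition skew_ring := rng_quot skew_gen.

Definition skew_class (x : L) : skew_ring := rng_pi skew_gen x.

(* The empty sum ([n = 0]) is allowed; for nonempty [S] it is also the
   one-term sum with zero coefficient. *)
Definition skew_diagonal : set skew_ring := [set q | exists n,
  exists (e : 'I_n -> S) (a : 'I_n -> A),
    (forall i, idem (e i) /\ D (e i) (a i)) /\
    q = \sum_(i < n) skew_class (delta (e i) (a i))].

Local Notation K := (smallest subgroup skew_gen).

Lemma skew_gen_mul (y z : L) : skew_gen z -> K (y ** z) /\ K (z ** y).
Proof.
have Ksub := subgroup_smallest skew_gen.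
move=> [r [s [a [rs dr ->]]]]; have ds := pdom_sub rs dr.
rewrite (fsE y) rngM_suml rngM_sumr; split; apply: subgroup_sum => // t _;
  move: (fs_dom y t) => dt; set b := y@_t in dt *.
  rewrite rngMBr !deltaM //; apply: sub_gen_smallest.
  exists (t * r)%g, (t * s)%g, (act t (act t^*%g b ** a)); split=> //.
    exact: natleMl.
  exact: (twist_dom (p := p)).
rewrite rngMBl !deltaM //; apply: sub_gen_smallest.
exists (r * t)%g, (s * t)%g, (act r (act r^*%g a ** b)); split=> //.
- exact: natleMr.
- exact: (twist_dom (p := p)).
have rs' := natle_star rs; congr (_ - delta _ _).
rewrite -(pact_sub rs'); last by rewrite star_star.
by rewrite (pact_sub rs) //; apply/pdomMr/pact_dom_star.
Qed.

Lemma K_ideal : ideal K.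
Proof.
have Ksub := subgroup_smallest skew_gen.
split=> // y z Kz.
pose J := [set z | K (y ** z) /\ K (z ** y)].
have : K `<=` J.
  apply: smallest_sub => [|w]; last exact: skew_gen_mul.
  split; first by rewrite /J /= rngM0 rng0M; split; exact: Ksub.1.
  move=> v w [hv hv'] [hw hw']; rewrite /J /= rngMBr rngMBl.
  by split; apply: Ksub.2.
by apply.
Qed.

Definition fs_total (x : {malg A[S]}) : A := \sum_(s <- msupp x) x@_s.

Lemma fs_totalE (d : {fset S}) (x : {malg A[S]}) :
  (msupp x `<=` d)%fset -> fs_total x = \sum_(s <- d) x@_s.
Proof. by move=> h; rewrite /fs_total (big_fset_incl _ h) // => s _ /mcoeff_outdom. Qed.

Lemma fs_totalB (x y : L) : fs_total (x - y) = fs_total x - fs_total y.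
Proof.
change (fs_total (val x - val y) = fs_total (val x) - fs_total (val y)).
move: (val x) (val y) => {}x {}y.
pose d := (msupp (x - y) `|` (msupp x `|` msupp y))%fset.
rewrite !(@fs_totalE d).
- by rewrite -sumrB; apply: eq_bigr => s _; rewrite mcoeffB.
- by rewrite /d fsubsetU // fsubsetUr orbT.
- by rewrite /d fsubsetU // fsubsetUl orbT.
- exact: fsubsetUl.
Qed.

Lemma fs_total_delta s a : D s a -> fs_total (delta s a) = a.
Proof.
move=> da; rewrite deltaE // (@fs_totalE [fset s]%fset) ?msuppU_le //.
by rewrite big_seq_fset1 mcoeffUU.
Qed.

Lemma fs_total0 : fs_total (0 : L) = 0.
Proof. by rewrite /fs_total msupp0 big_seq_fset0. Qed.

Lemma fs_total_ker (x : L) : skew_class x = 0 -> fs_total x = 0.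
Proof.
have -> : 0 = skew_class 0 by rewrite /skew_class raddf0.
move/rng_piE; rewrite subr0 => Nx.
have Kx : K x by apply: (smallest_sub K_ideal) Nx; exact: sub_gen_smallest.
have : K `<=` [set x : L | fs_total x = 0].
  apply: smallest_sub => [|_ [r [s [a [rs dr ->]]]]] /=.
    split=> /=; first exact: fs_total0.
    by move=> v w hv hw; rewrite /= fs_totalB hv hw subr0.
  by rewrite fs_totalB !fs_total_delta ?subrr //; exact: pdom_sub rs _.
by apply.
Qed.

Definition diag_word (l : seq (S * A)) :=
  forall x, x \in l -> idem x.1 /\ D x.1 x.2.
Definition dsum (l : seq (S * A)) : L := \sum_(x <- l) delta x.1 x.2.
Local Notation good := diag_word.

Lemma fs_total_dsum l : good l -> fs_total (dsum l) = \sum_(x <- l) x.2.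
Proof.
elim: l => [|[e a] l IH] h; first by rewrite /dsum !big_nil fs_total0.
have [_ da] := h _ (mem_head _ _).
rewrite /dsum !big_cons -/(dsum l) -[dsum l]opprK fs_totalB fs_total_delta //.
rewrite -[- dsum l]sub0r fs_totalB fs_total0 sub0r opprK IH // => x xl.
by apply: h; rewrite inE xl orbT.
Qed.

Lemma skew_classB : {morph skew_class : x y / x - y}.
Proof. exact: rng_piB. Qed.
Lemma skew_classD : {morph skew_class : x y / x + y}.
Proof. exact: rng_piD. Qed.
Lemma skew_classM : {morph skew_class : x y / x ** y}.
Proof. exact: rng_piM. Qed.
Lemma skew_class0 : skew_class 0 = 0.
Proof. exact: raddf0. Qed.

Lemma skew_class_sum (J : Type) (l : seq J) (F : J -> L) :
  skew_class (\sum_(j <- l) F j) = \sum_(j <- l) skew_class (F j).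
Proof. exact: raddf_sum. Qed.

Lemma skew_class_natle r s a : natle r s -> D r a ->
  skew_class (delta r a) = skew_class (delta s a).
Proof. by move=> rs dr; apply/rng_piE; apply: sub_gen_smallest; exists r, s, a. Qed.

Lemma skew_class_idem e f a : idem e -> idem f -> D e a -> D f a ->
  skew_class (delta e a) = skew_class (delta f a).
Proof.
move=> he hf de df; have def := pdom_capE he de df.
by rewrite -(skew_class_natle (natle_mulr e hf)) // (skew_class_natle (natle_mull f he)).
Qed.

Lemma dsum_ker l : good l -> \sum_(x <- l) x.2 = 0 -> skew_class (dsum l) = 0.
Proof.
have [n] := ubnP (size l); elim: n l => // n IH [|[e a] l] /=.
  by rewrite /dsum !big_nil skew_class0.
rewrite ltnS => sz h; rewrite big_cons /= => s0.
have [/= he da] := h _ (mem_head _ _).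
have {}h : good l by move=> x xl; apply: h; rewrite inE xl orbT.
have [u du ua] := local_unit lu da.
pose l' := [seq (x.1, x.2 - u ** x.2) | x <- l].
have : skew_class (dsum l') = 0.
  apply: IH; first by rewrite size_map.
    move=> _ /mapP[x xl ->] /=; have [hx dx] := h _ xl; split=> //.
    by apply: pdomB => //; exact: pdomMl.
  rewrite big_map /= sumrB -rngM_sumr.
  move/eqP: s0; rewrite addrC addr_eq0 => /eqP ->.
  by rewrite rngMN ua subrr.
rewrite /dsum big_cons /= skew_classD => l'0.
have : skew_class (delta e (a + \sum_(x <- l) u ** x.2)) = 0.
  by rewrite -rngM_sumr -{1}ua -rngMDr s0 rngM0 /Defs.delta;
     rewrite (_ : insubd _ _ = 0) ?skew_class0 //;
     apply: val_inj; rewrite val_insubd monalgU0; case: ifP.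
have dsumu : D e (\sum_(x <- l) u ** x.2).
  by apply: subgroup_sum => [|x _]; [case: (pdom_ideal p e)|exact: pdomMr].
rewrite deltaD // skew_classD => <-; congr (_ + _).
apply/eqP; rewrite -subr_eq0 -l'0 /l' big_map /=.
have -> : delta e (\sum_(x <- l) u ** x.2) = \sum_(x <- l) delta e (u ** x.2).
  apply: val_inj; rewrite [RHS](raddf_sum val) /= deltaE //.
  rewrite [LHS](raddf_sum (mkmalgU e)); apply: eq_bigr => x _ /=.
  by rewrite deltaE //; exact: pdomMr.
rewrite !skew_class_sum. rewrite -sumrB; apply/eqP.
rewrite big_seq [RHS]big_seq; apply: eq_bigr => x xl /=.
have [hx dx] := h _ xl.
have du' : D x.1 (u ** x.2) by exact: pdomMl.
rewrite (skew_class_idem he hx) //; last exact: pdomMr.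
apply/eqP; rewrite subr_eq -skew_classD -deltaD ?subrK //; exact: pdomB.
Qed.

Lemma good_ex a : exists l, good l /\ \sum_(x <- l) x.2 = a.
Proof.
have : [set: A] a by [].
rewrite -(pdom_gen p).
pose P := [set b | exists l, good l /\ \sum_(x <- l) x.2 = b].
suff : smallest subgroup (\bigcup_(e in idem) D e) `<=` P by apply.
apply: smallest_sub => [|b [e he db]].
- split; first by exists [::]; rewrite big_nil.
  move=> x y [l [gl <-]] [m [gm <-]].
  exists (l ++ [seq (z.1, - z.2) | z <- m]); split.
    move=> z; rewrite mem_cat => /orP[/gl //|/mapP[w /gm[hw dw] ->]].
    by split=> //=; exact: pdomN.
  by rewrite big_cat big_map /= sumrN.
- exists [:: (e, b)]; split; last by rewrite big_seq1.
  by move=> x; rewrite inE => /eqP -> /=.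
Qed.

(* The identification of [A] with [skew_diagonal]. *)
Theorem diagonal_iso : exists phi : A -> skew_ring,
  [/\ {morph phi : x y / x + y}, {morph phi : x y / x ** y},
      injective phi, range phi = skew_diagonal &
      forall e a, idem e -> D e a -> phi a = skew_class (delta e a)].
Proof.
have [l lP] := choice good_ex.
have gcat m m' : good m -> good m' -> good (m ++ m').
  by move=> gm gm' x; rewrite mem_cat => /orP[/gm|/gm'].
have dcat m m' : dsum (m ++ m') = dsum m + dsum m' by rewrite /dsum big_cat.
have phiE m : good m ->
    skew_class (dsum (l (\sum_(x <- m) x.2))) = skew_class (dsum m).
  move=> gm; set a := \sum_(x <- m) x.2; have [gl sl] := lP a.
  pose m' := [seq (z.1, - z.2) | z <- m].
  have gm' : good m'.
    by move=> _ /mapP[w /gm[hw dw] ->]; split=> //=; exact: pdomN.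
  have := dsum_ker (gcat _ _ gl gm'); rewrite big_cat big_map /= sl sumrN subrr.
  move=> /(_ erefl); rewrite dcat => h.
  apply/eqP; rewrite -subr_eq0 -skew_classB -h; apply/eqP; congr (skew_class (_ + _)).
  rewrite /m' /dsum big_map -sumrN big_seq [RHS]big_seq; apply: eq_bigr => x xm /=.
  have [_ dx] := gm _ xm.
  apply: val_inj; rewrite [LHS](raddfN val) /= !deltaE ?monalgUN //.
  exact: pdomN.
have phid e a : idem e -> D e a ->
    skew_class (dsum (l a)) = skew_class (delta e a).
  move=> he da; have := @phiE [:: (e, a)]; rewrite big_seq1 /dsum big_seq1.
  by apply=> x; rewrite inE => /eqP ->.
have phiD : {morph (fun a => skew_class (dsum (l a))) : x y / x + y}.
  move=> a b /=; rewrite -skew_classD -dcat -[RHS]phiE; last by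
    apply: gcat; [exact: (lP a).1|exact: (lP b).1].
  by rewrite big_cat /= (lP a).2 (lP b).2.
have phi0 : skew_class (dsum (l 0)) = 0.
  by apply: dsum_ker; case: (lP 0).
have phisum (J : Type) (r : seq J) (F : J -> A) :
    skew_class (dsum (l (\sum_(j <- r) F j))) = \sum_(j <- r) skew_class (dsum (l (F j))).
  by elim/big_rec2: _ => [|j x y _ <-] //; rewrite phiD.
exists (fun a => skew_class (dsum (l a))); split=> //.
- move=> a b /=; have [[ga sa] [gb sb]] := (lP a, lP b).
  rewrite -{1}sa -{1}sb rngM_suml phisum -skew_classM.
  rewrite /dsum rngM_suml skew_class_sum big_seq [RHS]big_seq.
  apply: eq_bigr => x /ga [hx dx] /=.
  rewrite rngM_sumr phisum rngM_sumr skew_class_sum big_seq [RHS]big_seq.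
  apply: eq_bigr => y /gb [hy dy] /=.
  rewrite deltaM // star_idem // (pact_idem hx dx) (pact_idem hx (pdomMr _ dx)).
  apply: (phid (x.1 * y.1)%g); first exact: idemM.
  by apply: pdom_capE => //; [exact: pdomMr|exact: pdomMl].
- move=> a b /= /eqP; rewrite -subr_eq0 -skew_classB => /eqP /fs_total_ker.
  rewrite fs_totalB !fs_total_dsum; [|exact: (lP b).1|exact: (lP a).1].
  by rewrite (lP a).2 (lP b).2 => /eqP; rewrite subr_eq0 => /eqP.
- apply/seteqP; split=> [_ [a _ <-]|_ [n [e [a [h ->]]]]] /=.
    have [ga sa] := lP a; pose m := l a.
    exists (size m), (fun i => (tnth (in_tuple m) i).1),
      (fun i => (tnth (in_tuple m) i).2); split.
      by move=> i; apply: ga; exact: mem_tnth.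
    by rewrite /dsum skew_class_sum big_tnth.
  exists (\sum_(i < n) a i) => //.
  rewrite phisum; apply: eq_bigr => i _; have [he da] := h i.
  exact: phid.
Qed.

End SkewRing.

Arguments skew_ring {S A p} lu.
Arguments skew_diagonal {S A p} lu _.

(* Main.v *)
(* Summing coefficients gives an additive map [total] on the skew ring that
   splits the embedding [diag] of [A] onto the diagonal.  If [x] centralizes the
   diagonal, then [total] vanishes on the ideal generated by
   [y = x - diag (total x)]; when the skew ring is simple this forces [y = 0],
   so [x] is diagonal.  An invariant ideal [I] of [A] is recovered by [total]
   from the ideal of the sums with coefficients in [I].  Conversely, if the
   diagonal is maximal commutative, every nonzero ideal meets it (shortest
   words), and its trace on [A] is a nonzero invariant ideal. *)

Require Import Defs.
From mathcomp Require Import all_boot all_algebra.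
From mathcomp Require Import finmap boolp classical_sets.
From mathcomp Require Import monalg.

Set Implicit Arguments.
Unset Strict Implicit.
Unset Printing Implicit Defensive.

Import GRing.Theory.

Local Open Scope classical_set_scope.
Local Open Scope ring_scope.

Section SkewTheory.
Context {S : inverseSemigroupType} {A : rngType} {p : partial_action S A}.
Variable lu : forall s, has_local_units (pdom p s).
Implicit Types (s t e : S) (a b c : A).

Local Notation D := (pdom p).
Local Notation act := (pact p).
Local Notation L := (formal_sum lu).
Local Notation R := (skew_ring lu).

(** * Single terms of the skew ring and words in them *)

Definition skew_term s a : R := skew_class (delta lu s a).

Lemma skew_termD s a b : D s a -> D s b ->
  skew_term s (a + b) = skew_term s a + skew_term s b.
Proof. by move=> da db; rewrite /skew_term deltaD // skew_classD. Qed.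

Lemma skew_term0 s : skew_term s 0 = 0.
Proof.
have d0 := pdom0 p s.
by apply: (@addrI _ (skew_term s 0)); rewrite -skew_termD // !addr0.
Qed.

Lemma skew_termB s a b : D s a -> D s b ->
  skew_term s (a - b) = skew_term s a - skew_term s b.
Proof.
move=> da db; apply: (@addIr _ (skew_term s b)).
by rewrite -skew_termD ?subrK //; exact: pdomB.
Qed.

Lemma skew_termM s t a b : D s a -> D t b ->
  skew_term s a ** skew_term t b = skew_term (s * t)%g (twist p s a b).
Proof. by move=> da db; rewrite /skew_term -skew_classM deltaM. Qed.

Lemma skew_term_natle s t a : natle s t -> D s a ->
  skew_term s a = skew_term t a.
Proof. exact: skew_class_natle. Qed.

Lemma twist_pdom s a b : D s a -> D s (twist p s a b).
Proof. by move=> da; apply/pact_dom/pdomMr/pact_dom_star. Qed.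

Lemma twist_idem e a b : idem e -> D e a -> twist p e a b = a ** b.
Proof.
move=> he da; rewrite /twist (star_idem he) (pact_idem he da).
by apply: pact_idem => //; exact: pdomMr.
Qed.

Definition word (l : seq (S * A)) := forall x, x \in l -> D x.1 x.2.

Definition word_sum (l : seq (S * A)) : R := \sum_(x <- l) skew_term x.1 x.2.

Lemma word_sumP (q : R) : exists l, word l /\ q = word_sum l.
Proof.
have [x ->] := rng_piP q.
exists [seq (s, x@_s) | s <- msupp x]; split.
  by move=> _ /mapP[s _ ->]; exact: fs_dom.
rewrite /word_sum big_map {1}(fsE x); exact: skew_class_sum.
Qed.

Lemma skew_ring_sub (I : set R) : subgroup I ->
  (forall s a, D s a -> I (skew_term s a)) -> forall q, I q.
Proof.
move=> Isub It q; have [l [wl ->]] := word_sumP q.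
by apply: subgroup_sum => // x /wl; exact: It.
Qed.

(** Serves, together with [skew_ring_sub], as an induction principle: an additive identity needs
    checking only on elements of the [D e], respectively on single terms. *)
Lemma base_ring_sub (I : set A) : subgroup I ->
  (forall e a, idem e -> D e a -> I a) -> forall a, I a.
Proof.
move=> Isub Ie a; have : [set: A] a by [].
rewrite -(pdom_gen p); apply: smallest_sub => // b [e he]; exact: Ie.
Qed.

(** * The embedding of the base ring and its products with terms *)

Definition diag : A -> R := projT1 (cid (diagonal_iso lu)).

Lemma diagP : [/\ {morph diag : x y / x + y}, {morph diag : x y / x ** y},
  injective diag, range diag = skew_diagonal lu &
  forall e a, idem e -> D e a -> diag a = skew_term e a].
Proof. by rewrite /diag; case: cid. Qed.

Lemma diagD : {morph diag : x y / x + y}. Proof. by case: diagP. Qed.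
Lemma diagM : {morph diag : x y / x ** y}. Proof. by case: diagP. Qed.
Lemma range_diag : range diag = skew_diagonal lu. Proof. by case: diagP. Qed.
Lemma diagE e a : idem e -> D e a -> diag a = skew_term e a.
Proof. by case: diagP => _ _ _ _; apply. Qed.

Lemma diag0 : diag 0 = 0.
Proof. by apply: (@addrI _ (diag 0)); rewrite -diagD !addr0. Qed.

Lemma diagB : {morph diag : x y / x - y}.
Proof. by move=> a b; apply: (@addIr _ (diag b)); rewrite -diagD !subrK. Qed.

(** For [a] in [D e] the product has index [e * s], which lies below [s], so the quotient allows the
    index [s] again. The general case follows by additivity in [a]. *)
Lemma diag_mul_term s a b : D s b ->
  diag a ** skew_term s b = skew_term s (a ** b).
Proof.
move=> db; move: a; apply: base_ring_sub => [|e a he da] /=.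
  split=> [|a a' ha ha'] /=; first by rewrite diag0 !rng0M skew_term0.
  by rewrite diagB !rngMBl ha ha' skew_termB //; exact: pdomMl.
rewrite (diagE he da) skew_termM // twist_idem //.
apply: skew_term_natle; first exact: natle_mull.
by apply: pdom_capE => //; [exact: pdomMr|exact: pdomMl].
Qed.

Lemma twistBr s a b b' : D s a ->
  twist p s a (b - b') = twist p s a b - twist p s a b'.
Proof.
move=> da; have h c : D s^*%g (act s^*%g a ** c).
  exact/pdomMr/pact_dom_star.
rewrite /twist rngMBr; apply: (@addIr _ (act s (act s^*%g a ** b'))).
by rewrite -pactDE ?subrK //; exact: pdomB.
Qed.

Lemma term_mul_diag s a b : D s b ->
  skew_term s b ** diag a = skew_term s (twist p s b a).
Proof.
move=> db; move: a; apply: base_ring_sub => [|e a he da] /=.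
  split=> [|a a' ha ha'] /=; first by rewrite diag0 twist0r rngM0 skew_term0.
  by rewrite diagB rngMBr ha ha' twistBr // skew_termB //; exact: twist_pdom.
rewrite (diagE he da) skew_termM //.
by apply: skew_term_natle; [exact: natle_mulr|exact: twist_dom].
Qed.

(** * The sum of coefficients on the skew ring *)

Definition total (q : R) : A := fs_total (repr q).

(** The choice of representative does not matter, because summing coefficients kills the ideal that
    is factored out ([fs_total_ker]). *)
Lemma total_class (x : L) : total (skew_class x) = fs_total x.
Proof.
have [y yE] : exists y : L, y = repr (skew_class x) by eexists.
rewrite /total -yE; apply/eqP; rewrite -subr_eq0 -fs_totalB; apply/eqP.
apply: fs_total_ker; rewrite skew_classB yE /skew_class /rng_pi reprK.
exact: subrr.
Qed.

Lemma totalB : {morph total : x y / x - y}.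
Proof.
move=> q r; have [[x ->] [y ->]] := (rng_piP q, rng_piP r).
by rewrite -rng_piB !total_class fs_totalB.
Qed.

Lemma total0 : total 0 = 0.
Proof. by rewrite -(subrr 0) totalB subrr. Qed.

Lemma total_term s a : D s a -> total (skew_term s a) = a.
Proof. by move=> da; rewrite total_class fs_total_delta. Qed.

Lemma total_diag a : total (diag a) = a.
Proof.
move: a; apply: base_ring_sub => [|e a he da] /=; last first.
  by rewrite (diagE he da) total_term.
by split=> [|a b ha hb] /=; rewrite ?diag0 ?total0 // diagB totalB ha hb.
Qed.

(** On a term [z] both products have the same coefficient and differ only in their index, which
    [total] forgets. *)
Lemma total_mul_term z t b : D t b ->
  total (z ** skew_term t b) = total (z ** diag b).
Proof.
move=> db; move: z; apply: skew_ring_sub => [|s a da] /=.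
  split=> [|x y hx hy] /=; first by rewrite !rng0M.
  by rewrite !rngMBl !totalB hx hy.
rewrite skew_termM // term_mul_diag // !total_term //; first exact: twist_pdom.
exact: twist_dom.
Qed.

(** The coefficient of a product of terms does not involve the index of the right factor, so [z]
    enters through its total only. *)
Lemma total_term_mul s a z : D s a ->
  total (skew_term s a ** z) = twist p s a (total z).
Proof.
move=> da; move: z; apply: skew_ring_sub => [|t b db] /=.
  split=> [|x y hx hy] /=; first by rewrite rngM0 total0 twist0r.
  by rewrite rngMBr !totalB hx hy twistBr.
by rewrite skew_termM // !total_term //; exact: twist_dom.
Qed.


(* Modulo [total_mul_term], right factors can be taken in the diagonal, where
   they move past [y]. *)
Lemma total_sandwich z y w : centralizer (skew_diagonal lu) y ->
  total y = 0 -> total (z ** y ** w) = 0.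
Proof.
rewrite -range_diag => yC y0; move: w; apply: skew_ring_sub => [|t b db] /=.
  split=> [|v w hv hw] /=; first by rewrite rngM0 total0.
  by rewrite rngMBr totalB hv hw subr0.
rewrite total_mul_term // -rngMA yC; last by exists b.
rewrite rngMA; move: (z ** _); apply: skew_ring_sub => [|s a da] /=.
  split=> [|v w hv hw] /=; first by rewrite rng0M total0.
  by rewrite rngMBl totalB hv hw subr0.
by rewrite total_term_mul // y0 twist0r.
Qed.

(** * From simplicity of the skew ring to [S]-simplicity of the base *)

Lemma base_local_unit (luA : has_local_units [set: A]) a :
  exists u, u ** a ** u = a.
Proof.
have [//|u [_ uu]] := luA [:: a].
move=> /(_ a (mem_head _ _)) [b _ ->]; exists u.
by rewrite !rngMA uu -!rngMA uu.
Qed.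

Lemma simple_S_simple : has_local_units [set: A] -> simple_rng R -> S_simple p.
Proof.
move=> luA Rsimple I [Isub Imul] Iinv.
have Iact s a : I a -> D s^*%g a -> I (act s a).
  by move=> ia da; apply: (Iinv s); exists a.
pose X : set R := [set q | exists s a, [/\ I a, D s a & q = skew_term s a]].
pose J := smallest subgroup X.
have Jsub : subgroup J := subgroup_smallest X.
have JX q : X q -> J q := @sub_gen_smallest _ _ _ q.
have Ji : ideal J.
  split=> // r; suff : J `<=` [set q | J (r ** q) /\ J (q ** r)] by apply.
  apply: smallest_sub => [|_ [s [a [ia da ->]]]] /=.
    split=> [|q q' [h1 h2] [h1' h2']] /=.
      by rewrite rngM0 rng0M; split; exact: Jsub.1.
    by rewrite rngMBr rngMBl; split; apply: Jsub.2.
  move: r; apply: skew_ring_sub => [|t b db] /=.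
    split=> [|q q' [h1 h2] [h1' h2']] /=.
      by rewrite rngM0 rng0M; split; exact: Jsub.1.
    by rewrite rngMBr rngMBl; split; apply: Jsub.2.
  rewrite !skew_termM //; split; apply: JX.
    exists (t * s)%g, (twist p t b a); split=> //; last exact: twist_dom.
    by apply: Iact; [exact: (Imul _ _ ia).1|exact/pdomMr/pact_dom_star].
  exists (s * t)%g, (twist p s a b); split=> //; last exact: twist_dom.
  (* The coefficient is pulled back along [s], multiplied by [b] and pushed forward; each move stays
     in [I]. *)
  have ia' : I (act s^*%g a) by apply: Iact; rewrite ?star_star.
  by apply: Iact; [exact: (Imul _ _ ia').2|exact/pdomMr/pact_dom_star].
case: (Rsimple J Ji) => JE; [left|right]; apply/seteqP; split=> // a.
(* An element [a] of [I] need not lie in a single [D e], but [b ** a] does for [b] in [D e]. Its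
   term is in [J], which is zero here, so all products [b ** a] vanish, and with them
   [u ** a ** u]. *)
- have [u ua] := base_local_unit luA a; move=> ia; rewrite /= -ua.
  suff ba0 : forall b, b ** a = 0 by rewrite ba0 rng0M.
  apply: base_ring_sub => [|e b he db].
    split=> [|b b' h h'] /=; first by rewrite rng0M.
    by rewrite rngMBl h h' subr0.
  have dba : D e (b ** a) by exact: pdomMr.
  suff h : skew_term e (b ** a) = 0 by rewrite -(total_term dba) h total0.
  suff : J (skew_term e (b ** a)) by rewrite JE.
  by apply: JX; exists e, (b ** a); split=> //; exact: (Imul _ _ ia).1.
- by move=> ->; exact: Isub.1.
(* Here [J] is everything: [total] maps it into [I], yet reaches every [a] through [diag a]. *)
- move=> _; suff JI : J `<=` [set q | I (total q)].
    by rewrite -(total_diag a); apply: JI; rewrite JE.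
  apply: smallest_sub => [|_ [s [b [ib db ->]]]] /=; last by rewrite total_term.
  split=> [|q q' h h'] /=; first by rewrite total0; exact: Isub.1.
  by rewrite totalB; exact: Isub.2.
Qed.

(** * Operations on words that preserve length *)

(** Controls the tail of a word under products and commutators in the descent on length: [G] is
    applied letter by letter. *)
Lemma word_sum_map (G : R -> R) (l : seq (S * A)) :
  {morph G : x y / x - y} ->
  (forall s a, D s a ->
    exists t b, D t b /\ G (skew_term s a) = skew_term t b) ->
  word l -> exists l', [/\ size l' = size l, word l' &
    G (word_sum l) = word_sum l'].
Proof.
move=> GB Gt.
have G0 : G 0 = 0 by rewrite -{1}(subrr 0) GB subrr.
have GD x y : G (x + y) = G x + G y.
  by apply/eqP; rewrite -subr_eq -GB addrK.
elim: l => [|[s a] l IH] wl; first by exists [::]; rewrite /word_sum !big_nil.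
have [l' [sl' wl' El']] : exists l', [/\ size l' = size l, word l' &
    G (word_sum l) = word_sum l'].
  by apply: IH => x xl; apply: wl; rewrite inE xl orbT.
have [t [b [db Eb]]] := Gt s a (wl _ (mem_head _ _)).
exists ((t, b) :: l'); split; first by rewrite /= sl'.
  by move=> x; rewrite inE => /orP[/eqP -> //|/wl'].
by rewrite /word_sum !big_cons GD Eb -/(word_sum l) El'.
Qed.

End SkewTheory.

Section CommutativeBase.
Context {S : inverseSemigroupType} {A : comRngType} {p : partial_action S A}.
Variable lu : forall s, has_local_units (pdom p s).
Implicit Types (s t e : S) (a b c : A).

Local Notation D := (pdom p).
Local Notation act := (pact p).
Local Notation R := (skew_ring lu).
Local Notation diag := (diag lu).
Local Notation term := (skew_term lu).
Local Notation word := (@word S A p).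

(** * Commutative base: the centralizer of the diagonal and ideals that meet the diagonal *)

Lemma diagC a b : diag a ** diag b = diag b ** diag a.
Proof. by rewrite -!diagM rngMC. Qed.

Lemma simple_centralizer : has_local_units [set: A] -> simple_rng R ->
  centralizer (skew_diagonal lu) `<=` skew_diagonal lu.
Proof.
move=> luA Rsimple x xC; pose y := x - diag (total x).
suff y0 : y = 0.
  rewrite -range_diag; exists (total x) => //.
  by apply/esym/eqP; rewrite -subr_eq0 -/y y0.
have ty : total y = 0 by rewrite totalB total_diag subrr.
have yC : centralizer (skew_diagonal lu) y.
  move=> z zD; rewrite /y rngMBr rngMBl xC //.
  by move: zD; rewrite -range_diag => -[a _ <-]; rewrite diagC.
(* Quantifying over all [z] and [w] makes [J] an ideal at once, without describing the ideal
   generated by [y]. *)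
pose J : set R := [set q | forall z w, total (z ** q ** w) = 0].
have Ji : ideal J.
  split=> [|a q Jq].
    split=> [z w|q r Jq Jr z w]; first by rewrite rngM0 rng0M total0.
    by rewrite rngMBr rngMBl totalB Jq Jr subr0.
  split=> z w; first by rewrite rngMA; exact: Jq.
  by rewrite rngMA -rngMA; exact: Jq.
have Jy : J y by move=> z w; exact: total_sandwich.
case: (Rsimple J Ji) => JE; first by rewrite JE in Jy.
(* In the remaining case [J] is everything, so [total] of [diag u ** diag a ** diag u] is both [0]
   and [a]. Then all coefficients vanish and the skew ring is zero. *)
have A0 a : a = 0.
  have [u <-] := base_local_unit luA a.
  rewrite -(total_diag lu (_ ** u)) !diagM.
  by have : J (diag a) by rewrite JE.
move: y {yC ty Jy}; apply: skew_ring_sub => [|s a da] /=.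
  by split=> //= q r -> ->; rewrite subr0.
by rewrite (A0 a) skew_term0.
Qed.

(* A nonzero word of minimal length in the ideal, shifted so that its first
   letter is idempotent, commutes with the diagonal since each commutator is a
   shorter word. *)
Lemma ideal_diag (J : set R) : ideal J ->
  centralizer (skew_diagonal lu) `<=` skew_diagonal lu ->
  (exists2 q, J q & q <> 0) -> exists2 a, J (diag a) & a <> 0.
Proof.
move=> [Jsub Jmul] maxD [q Jq q0]; have [l [wl ql]] := word_sumP q.
move: Jq q0; rewrite {q}ql.
have [n] := ubnP (size l); elim: n l wl => // n IH [|[s a] l] wl /=.
  by rewrite /word_sum big_nil.
rewrite ltnS => sz Jq q0.
have da : D s a := wl _ (mem_head _ _).
have {}wl : word l by move=> x xl; apply: wl; rewrite inE xl orbT.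
move: Jq q0; rewrite {1 2}/word_sum big_cons /= -/(word_sum lu l) => Jq q0.
set q := term s a + _ in Jq q0.
have shorter r l' : word l' -> size l' = size l -> J r -> r = word_sum lu l' ->
    r <> 0 -> exists2 c, J (diag c) & c <> 0.
  by move=> wl' sl' Jr rE r0; apply: (IH l') => //; rewrite ?sl' // -rE.
(* Since [u] fixes the pulled-back first coefficient, [diag u] on the right keeps the first letter,
   and [q - q ** diag u] is a sum over a shorter word. *)
have [u du ua] := local_unit lu (pact_dom_star da).
have tu : twist p s a u = a by rewrite /twist rngMC ua pactK.
have [h|ne] := pselect (q - q ** diag u <> 0).
  have [l' [sl' wl' El']] : exists l', [/\ size l' = size l, word l' &
      word_sum lu l - word_sum lu l ** diag u = word_sum lu l'].
    apply: (@word_sum_map _ _ _ _ (fun x => x - x ** diag u)) => //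
      [x y|t c dc].
      by rewrite rngMBl !opprD addrACA.
    exists t, (c - twist p t c u); split; first exact/pdomB/twist_pdom.
    by rewrite term_mul_diag // skew_termB //; exact: twist_pdom.
  apply: (shorter _ l') h => //.
    by apply: Jsub.2 => //; exact: (Jmul _ _ Jq).2.
  by rewrite -El' /q rngMDl term_mul_diag // tu opprD addrACA subrr add0r.
have {ne} qu : q = q ** diag u.
  by apply/eqP; rewrite -subr_eq0; apply/eqP; apply: contrapT.
(* The shift gives the first letter the idempotent index [s * s^*] and keeps its coefficient [a]. *)
pose q' := q ** term s^*%g u.
have Jq' : J q' by exact: (Jmul _ _ Jq).2.
have q'0 : q' <> 0.
  move=> h; apply: q0; rewrite qu.
  (* The shift can be undone: [diag u] is the product of [term s^* u] and [term s v], so [q' = 0]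
     would give [q = q ** diag u = 0]. *)
  have [v dv va] := local_unit lu (pact_dom du).
  have dsu : D (s^* * s)%g u by have := pdom_mul_star du; rewrite star_star.
  rewrite (diagE lu (idem_star_mul s) dsu).
  have -> : u = twist p s^*%g u v.
    by rewrite /twist star_star rngMC va pactsK.
  by rewrite -skew_termM // rngMA -/q' h rng0M.
have [l' [sl' wl' El']] : exists l', [/\ size l' = size l, word l' &
    word_sum lu l ** term s^*%g u = word_sum lu l'].
  apply: (@word_sum_map _ _ _ _ (fun x => x ** term s^*%g u)) => //
      [x y|t c dc].
    exact: rngMBl.
  exists (t * s^*)%g, (twist p t c u); split; first exact: twist_dom.
  exact: skew_termM.
have q'E : q' = diag a + word_sum lu l'.
  rewrite /q' /q rngMDl El' skew_termM // tu.
  by rewrite (diagE lu (idem_mul_star s)) //; exact: pdom_mul_star.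
have [[b hb]|comm] := pselect (exists b, q' ** diag b - diag b ** q' <> 0).
  have [l2 [sl2 wl2 El2]] : exists l2, [/\ size l2 = size l', word l2 &
      word_sum lu l' ** diag b - diag b ** word_sum lu l' = word_sum lu l2].
    apply: (@word_sum_map _ _ _ _ (fun x => x ** diag b - diag b ** x)) => //
      [x y|t c dc].
      by rewrite rngMBl rngMBr !opprD addrACA.
    exists t, (twist p t c b - b ** c); split.
      by apply: pdomB; [exact: twist_pdom|exact: pdomMl].
    rewrite term_mul_diag // diag_mul_term // skew_termB //;
      [exact: twist_pdom|exact: pdomMl].
  apply: (shorter _ l2) hb => //; first by rewrite sl2.
    by apply: Jsub.2; [exact: (Jmul _ _ Jq').2|exact: (Jmul _ _ Jq').1].
  by rewrite -El2 q'E rngMDl rngMDr diagC opprD addrACA subrr add0r.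
have : skew_diagonal lu q'.
  apply: maxD => z; rewrite -range_diag => -[b _ <-].
  apply/eqP; rewrite -subr_eq0; apply/eqP; apply: contrapT => h.
  by apply: comm; exists b.
rewrite -range_diag => -[c _ cE]; exists c; first by rewrite cE.
by move=> c0; apply: q'0; rewrite -cE c0 diag0.
Qed.

(** * From [S]-simplicity and maximal commutativity to simplicity *)

Lemma S_simple_maxcomm_simple : S_simple p ->
  centralizer (skew_diagonal lu) `<=` skew_diagonal lu -> simple_rng R.
Proof.
move=> Asimple maxD J Ji; have [Jsub Jmul] := Ji.
have [nz|/contrapT J0] := pselect (~ J `<=` [set 0]); last first.
  by left; apply/seteqP; split=> // _ ->; exact: Jsub.1.
right; have [a Ja a0] : exists2 a, J (diag a) & a <> 0.
  apply: ideal_diag => //; apply: contrapT => h; apply: nz => q Jq.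
  by apply: contrapT => q0; apply: h; exists q.
pose I : set A := [set a | J (diag a)].
have Ii : ideal I.
  split=> [|b c Jc].
    split=> [|b c Jb Jc]; rewrite /I /= ?diag0 ?diagB; first exact: Jsub.1.
    exact: Jsub.2.
  by rewrite /I /= !diagM; exact: Jmul.
have Iinv : S_invariant p I.
  move=> s _ [b [Jb db] <-].
  have [u du ub] := local_unit lu db.
  have tb : twist p s (act s u) b = act s b by rewrite /twist pactsK // ub.
  rewrite /I /=.
  (* The action of [s] becomes a two-sided product around [diag b]; the local unit [u] of [b]
     supplies the coefficients of the outer factors. *)
  have -> : diag (act s b) = term s (act s u) ** diag b ** term s^*%g u.
    rewrite term_mul_diag ?tb; last exact: pact_dom.
    rewrite skew_termM //; last exact: pact_dom.
    rewrite /twist pactsK // rngMC ub (diagE lu (idem_mul_star s)) //.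
    exact/pdom_mul_star/pact_dom.
  exact/(Jmul _ _ _).2/(Jmul _ _ _).1.
have IT : I = setT.
  by case: (Asimple I Ii Iinv) => // I0; case: a0; have : I a by []; rewrite I0.
apply/seteqP; split=> // q _; move: q; apply: skew_ring_sub => // s b db.
(* A local unit [u] of [b] gives [term s b = diag u ** term s b], and [diag u] is in [J]. *)
have [u du ub] := local_unit lu db.
rewrite -ub -diag_mul_term //; apply: (Jmul _ _ _).2.
by have : I u by rewrite IT.
Qed.

End CommutativeBase.

Theorem theorem3p7 (S : inverseSemigroupType) (A : comRngType)
    (p : partial_action S A)
    (luA : has_local_units [set: A])
    (luD : forall s : S, has_local_units (pdom p s)) :
  simple_rng (skew_ring luD) <->
  S_simple p /\ maximal_commutative (skew_diagonal luD).
Proof.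
split=> [Rsimple|[Asimple maxD]].
  split; first exact: simple_S_simple Rsimple.
  apply/seteqP; split; first exact: simple_centralizer.
  rewrite -range_diag => _ [a _ <-] _ [b _ <-]; exact: diagC.
by apply: S_simple_maxcomm_simple => //; rewrite maxD.
Qed.
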